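(* Let $M=(E,r)$ be a matroid with $E$ nonempty, and write $r(M)=r(E)$. Then \[ Q'_M(x,y)=\frac{x^{|E|-r(M)}\,y^{r(M)}}{x+y-1}\cdot T_M\!\left(\frac{x+y-1}{y},\ \frac{x+y-1}{x}\right), \] as an identity of rational functions.
   Context: For a polymatroid (in particular a matroid) $M=(E,r)$ with ground set $E$, a base is a vector $\mathbf x\in\mathbb Z^E$ with $\sum_{i\in E}x_i=r(E)$ and $\sum_{i\in S}x_i\le r(S)$ for all $S\subseteq E$; $P(M)$ is the convex hull of the bases. For a matroid, the bases are exactly the indicator vectors $\mathbf e_B$ of the matroid bases $B$. Let $\Delta=\operatorname{conv}\{\mathbf e_i:i\in E\}\subseteq\mathbb R^E$ and $\nabla=-\Delta$. For integers $t,u\ge 0$ let $Q_M(t,u)=\#\big((P(M)+u\Delta+t\nabla)\cap\mathbb Z^E\big)$ (Minkowski sum). This is a polynomial in $t,u$ (of degree $|E|-1$); write it uniquely as $Q_M(t,u)=\sum_{i,j}c_{ij}\binom{u}{j}\binom{t}{i}$ and define $Q'_M(x,y)=\sum_{i,j}c_{ij}(x-1)^i(y-1)^j$. The Tutte polynomial is $T_M(x,y)=\sum_{S\subseteq E}(x-1)^{r(E)-r(S)}(y-1)^{|S|-r(S)}$. *)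

(* Defs.v *)
From HB Require Import structures.
From mathcomp Require Import all_boot all_order all_algebra.
Set Implicit Arguments. Unset Strict Implicit. Unset Printing Implicit Defensive.
Import Order.TTheory GRing.Theory Num.Theory.
Local Open Scope ring_scope.

Section Defs.
Variable T : finType.

Definition matroid_rank (r : {set T} -> nat) : Prop :=
  [/\ forall A : {set T}, (r A <= #|A|)%N,
      forall A B : {set T}, A \subset B -> (r A <= r B)%N
    & forall A B : {set T}, (r (A :|: B) + r (A :&: B) <= r A + r B)%N].

Definition is_basis (r : {set T} -> nat) (B : {set T}) : bool :=
  (#|B| == r B) && (r B == r setT).

(* z lies in P(M) + u.Delta + t.Nabla, computed in an ordered field R.
   P(M) = conv{ e_B : B basis }, u.Delta = {a >= 0, sum a = u},
   t.Nabla = {b <= 0, sum b = -t}. *)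
Definition in_minkowski (R : realFieldType) (r : {set T} -> nat) (t u : nat)
    (z : {ffun T -> int}) : Prop :=
  exists (lam : {ffun {set T} -> R}) (a b : {ffun T -> R}),
    [/\ (forall B, 0 <= lam B),
        (forall B, lam B != 0 -> is_basis r B)
      & \sum_(B : {set T}) lam B = 1] /\
    [/\ (forall i, 0 <= a i), \sum_i a i = u%:R,
         (forall i, b i <= 0) & \sum_i b i = - t%:R] /\
    (forall i, (z i)%:~R = \sum_(B : {set T}) lam B * (i \in B)%:R + a i + b i).

Definition card_is (P : {ffun T -> int} -> Prop) (N : nat) : Prop :=
  exists s : seq {ffun T -> int},
    [/\ uniq s, size s = N & forall z, z \in s <-> P z].

Definition tutte (K : fieldType) (r : {set T} -> nat) (x y : K) : K :=
  \sum_(S : {set T}) (x - 1) ^+ (r setT - r S) * (y - 1) ^+ (#|S| - r S).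

Definition Qbinom (c : {ffun 'I_#|T| * 'I_#|T| -> int}) (t u : nat) : int :=
  \sum_(i < #|T|) \sum_(j < #|T|) c (i, j) * ('C(u, j))%:Z * ('C(t, i))%:Z.

Definition Qprime (K : fieldType) (c : {ffun 'I_#|T| * 'I_#|T| -> int}) (x y : K) : K :=
  \sum_(i < #|T|) \sum_(j < #|T|) (c (i, j))%:~R * (x - 1) ^+ i * (y - 1) ^+ j.

End Defs.

(* Main.v *)
(** Identify [z] off a fixed element [e] with [e_P + a - b], where [P] is the set of
    [i != e] with [z_i > 0] and [a], [b] are supported on [P] and on the complement of
    [P + e]. With [sum z = r(E) + u - t], the point [z] lies in the Minkowski sum iff
    [z(S) <= r(S) + u] for [S = P] and [S = P + e]: one of these two sets is
    [{z > 0}], and a basis [B] meeting [{z > 0}] in a set of full rank gives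
    [z = e_B + (z - e_B)^+ - (z - e_B)^-] with parts small enough. These conditions
    decouple into [|a| + null(P) <= u] and [|b| + cork(P + e) <= t], so that
    [Q(t,u) = sum_{P not containing e} C(u + r(P), |P|) C(t + m, n - 1 - |P|)] with
    [m = n - 1 - |P| - cork(P + e)]. Vandermonde's identity turns this into
    [Q'(x,y) = sum_P (x-1)^cork(P+e) x^m (y-1)^null(P) y^r(P)], and multiplying the summand
    of [P] by [x + y - 1] gives the rescaled Tutte terms of [P] and of [P + e]. *)
Require Import Defs.
From HB Require Import structures.
From mathcomp Require Import all_boot all_order all_algebra.
From mathcomp Require Import zify ring.
Import Order.TTheory GRing.Theory Num.Theory.
Local Open Scope ring_scope.

(** * Rank functions, independent sets and bases *)

Section MatroidRank.
Variables (T : finType) (r : {set T} -> nat).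
Hypothesis r_matroid : matroid_rank r.
Implicit Types (A B I J S : {set T}) (e : T).

Lemma rank_le_card A : (r A <= #|A|)%N.
Proof. by case: r_matroid. Qed.

Lemma rankS A B : A \subset B -> (r A <= r B)%N.
Proof. by case: r_matroid => _ + _; apply. Qed.

Lemma rank_submod A B : (r (A :|: B) + r (A :&: B) <= r A + r B)%N.
Proof. by case: r_matroid. Qed.

Lemma rankU_le A B : (r (A :|: B) <= r A + #|B|)%N.
Proof. by have := rank_submod A B; have := rank_le_card B; lia. Qed.

Lemma rankU1_le A e : (r (e |: A) <= (r A).+1)%N.
Proof. by have := rankU_le A [set e]; rewrite cards1 setUC addn1. Qed.

Lemma corank_nullity_le A : (r setT + #|A| <= #|T| + r A)%N.
Proof. by have := rankU_le A (~: A); have := cardsC A; rewrite setUCr; lia. Qed.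

(** Submodularity gives [r I <= r (I :&: S) + #|I :\: S|], so [I :&: S] is again independent;
    monotonicity then bounds its size by [r S]. *)
Lemma indep_cardI_le I S : #|I| = r I -> (#|I :&: S| <= r S)%N.
Proof.
move=> indI; have := rankU_le (I :&: S) (I :\: S); rewrite setID.
have := cardsID S I; have := rankS (I :&: S) S (subsetIr _ _); lia.
Qed.

Lemma rank_span A J : J \subset A ->
  (forall x, x \in A -> r (x |: J) = r J) -> r A = r J.
Proof.
move=> sJA spanJ.
suff rU n (X : {set T}) : #|X| = n -> X \subset A -> r (J :|: X) = r J.
  by rewrite -{1}(setUidPr sJA) (rU #|A|).
elim: n X => [|n IHn] X cX sXA; first by rewrite (cards0_eq cX) setU0.
have [x Xx] : exists x, x \in X by apply/card_gt0P; rewrite cX.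
have cX' : #|X :\ x| = n by have := cardsD1 x X; rewrite Xx cX; lia.
have sX'A : X :\ x \subset A by apply: subset_trans sXA; apply: subsetDl.
have := rank_submod (J :|: (X :\ x)) (x |: J).
rewrite (IHn _ cX' sX'A) (spanJ x (subsetP sXA x Xx)).
have -> : J :|: X :\ x :|: (x |: J) = J :|: X.
  apply/setP=> i; rewrite !inE; have [->|_] := eqVneq i x; rewrite ?Xx ?orbT //=.
  by rewrite orbAC orbb.
have := rankS J ((J :|: X :\ x) :&: (x |: J)).
rewrite subsetI subsetUl subsetUr => /(_ isT).
have := rankS J (J :|: X) (subsetUl _ _); lia.
Qed.

(** A largest independent [J] between [I] and [A] works: an element of [A] that raised its rank
    would give a larger independent set, so [J] spans [A]. *)
Lemma indep_extend A I : #|I| = r I -> I \subset A ->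
  exists J, [/\ I \subset J, J \subset A, #|J| = r J & r J = r A].
Proof.
move=> indI sIA.
pose ok J := [&& I \subset J, J \subset A & #|J| == r J].
have okI : ok I by rewrite /ok subxx sIA indI eqxx.
case: (arg_maxnP (fun J => #|J|) okI) => J /and3P[sIJ sJA /eqP indJ] maxJ.
exists J; split=> //; apply/esym/rank_span => // x Ax.
have [Jx|nJx] := boolP (x \in J); first by rewrite (setUidPr _) ?sub1set.
have cxJ := cardsU1 x J; rewrite nJx in cxJ.
have leJ := rankS J (x |: J) (subsetUr _ _).
have := rankU1_le J x; rewrite leq_eqVlt => /orP[/eqP rxJ|]; last lia.
have /maxJ : ok (x |: J).
  rewrite /ok subUset sub1set Ax sJA (subset_trans sIJ (subsetUr _ _)) /=; lia.
by rewrite /= in cxJ *; lia.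
Qed.

(** The empty set is extended to a maximal independent subset of [S], and that subset to a basis. *)
Lemma exists_basis_cover S :
  exists2 B, is_basis r B & (r S <= #|B :&: S|)%N.
Proof.
have r0 : #|@set0 T| = r set0 by have := rank_le_card set0; rewrite cards0; lia.
have [J [_ sJS indJ rJ]] := indep_extend S set0 r0 (sub0set _).
have [B [sJB _ indB rB]] := indep_extend setT J indJ (subsetT _).
exists B; first by rewrite /is_basis indB rB !eqxx.
by rewrite -rJ -indJ subset_leq_card // subsetI sJB.
Qed.

End MatroidRank.

(** * Membership in the Minkowski sum through rank inequalities *)

Section Membership.
Variables (R : realFieldType) (T : finType) (r : {set T} -> nat).
Hypothesis r_matroid : matroid_rank r.
Variables (t u : nat) (z : {ffun T -> int}).

Lemma in_minkowski_sum : in_minkowski R r t u z ->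
  \sum_i z i = (r setT)%:Z + u%:Z - t%:Z.
Proof.
case=> lam [a [b [[lam0 lamB lam1] [[a0 sa b0 sb] zE]]]].
apply/eqP; rewrite -(eqr_int R) rmorph_sum /= (eq_bigr _ (fun i _ => zE i)).
rewrite !big_split /= sa sb exchange_big /=.
rewrite (eq_bigr (fun B => lam B * (r setT)%:R)); last first.
  move=> B _; rewrite -mulr_sumr -natr_sum -big_mkcond sum1_card.
  have [->|/lamB/andP[/eqP cB /eqP rB]] := eqVneq (lam B) 0; first by rewrite !mul0r.
  by rewrite -rB -cB; congr (_ * _%:R); apply: eq_card => i; rewrite inE.
by rewrite -mulr_suml lam1 mul1r rmorphB rmorphD /= -!pmulrn.
Qed.

(** On [S], each basis contributes at most [r S], [a] at most its total [u], and [b] nothing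
    positive. *)
Lemma in_minkowski_le (S : {set T}) : in_minkowski R r t u z ->
  \sum_(i in S) z i <= (r S)%:Z + u%:Z.
Proof.
case=> lam [a [b [[lam0 lamB lam1] [[a0 sa b0 sb] zE]]]].
rewrite -(ler_int R) rmorph_sum /= (eq_bigr _ (fun i _ => zE i)).
rewrite !big_split /= rmorphD /= -!pmulrn -[leRHS]addr0; apply: lerD; first apply: lerD.
- have -> : (r S)%:R = \sum_B lam B * (r S)%:R by rewrite -mulr_suml lam1 mul1r.
  rewrite exchange_big /=; apply: ler_sum => B _.
  rewrite -mulr_sumr; have [->|/lamB/andP[/eqP cB _]] := eqVneq (lam B) 0.
    by rewrite !mul0r.
  rewrite ler_wpM2l // -natr_sum ler_nat -big_mkcondr sum1_card.
  apply: leq_trans (indep_cardI_le _ _ r_matroid B S cB).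
  by apply/eq_leq/eq_card => i; rewrite !inE andbC.
- by rewrite -sa [leRHS](bigID (mem S)) /= lerDl sumr_ge0.
- exact: sumr_le0.
Qed.

(** The convex combination is the point mass at one basis [B] that meets the positive support [P] in
    full rank; the rest [y] of [z] is split by sign, and [e] only hosts the slack. *)
Lemma in_minkowski_intro (e : T) :
  \sum_i z i = (r setT)%:Z + u%:Z - t%:Z ->
  \sum_(i | 0 < z i) z i <= (r [set i | 0 < z i])%:Z + u%:Z ->
  in_minkowski R r t u z.
Proof.
set P := [set i | 0 < z i] => sumz leP.
have [B /andP[/eqP cB /eqP rB] leB] := exists_basis_cover _ _ r_matroid P.
pose y i : int := z i - (i \in B)%:Z.
(* The slack [k] is added to the positive part and subtracted from the negative part at [e]. *)
pose p i : int := if 0 < z i then y i else 0.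
pose k : int := u%:Z - \sum_i p i.
pose d i : int := if i == e then k else 0.
have sumB (Q : pred T) : \sum_(i | Q i) (i \in B)%:Z = #|[set i in B | Q i]|%:Z.
  rewrite -(big_morph Posz PoszD (erefl 0%:Z)) -big_mkcondr sum1_card; congr Posz.
  by apply: eq_card => i; rewrite !inE andbC.
have sumy : \sum_i y i = u%:Z - t%:Z.
  rewrite sumrB sumz sumB.
  have -> : #|[set i in B | true]| = r setT.
    by rewrite -rB -cB; apply: eq_card => i; rewrite inE andbT.
  by lia.
have sumd : \sum_i d i = k by rewrite -big_mkcond big_pred1_eq.
(* The choice of [B] enters here: the sum of [p] is [z(P) - #|B :&: P|], at most [z(P) - r P], hence
   at most [u]. *)
have k0 : 0 <= k.
  rewrite /k -big_mkcond sumrB sumB.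
  have -> : [set i in B | 0 < z i] = B :&: P by apply/setP=> i; rewrite !inE.
  by rewrite subr_ge0 lerBlDr (le_trans leP) // addrC lerD2l lez_nat.
have d0 i : 0 <= d i by rewrite /d; case: eqP.
(* By integrality [0 < z i] means [z i >= 1], so [y i >= 0] there and [y i <= 0] elsewhere: [p] is
   the positive part of [y]. *)
have p0 i : 0 <= p i by rewrite /p /y; case: ifP; case: (i \in B); lia.
have yp i : y i <= p i by rewrite /p /y; case: ifP; case: (i \in B); lia.
exists [ffun A => (A == B)%:R], [ffun i => (p i + d i)%:~R],
  [ffun i => (y i - p i - d i)%:~R]; split; first split.
- by move=> A; rewrite ffunE ler0n.
- by move=> A; rewrite ffunE; have [->|_] := eqVneq A B; rewrite ?eqxx // /is_basis cB rB !eqxx.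
- rewrite (bigD1 B) //= ffunE eqxx big1 ?addr0 // => A /negPf nAB.
  by rewrite ffunE nAB.
split; first split.
- by move=> i; rewrite ffunE ler0z addr_ge0.
- under eq_bigr do rewrite ffunE.
  by rewrite -rmorph_sum big_split /= sumd /k addrC subrK.
- by move=> i; rewrite ffunE lerz0; have := d0 i; have := yp i; lia.
- under eq_bigr do rewrite ffunE.
  rewrite -rmorph_sum 2!sumrB sumd sumy /k.
  have -> : - t%:R = (- t%:Z)%:~R :> R by rewrite rmorphN /= -pmulrn.
  congr (_%:~R).
  by ring.
move=> i; rewrite (bigD1 B) //= !ffunE eqxx mul1r big1 ?addr0; last first.
  by move=> A /negPf nAB; rewrite ffunE nAB mul0r.
rewrite (pmulrn 1 (i \in B)) -!rmorphD /=; congr (_%:~R).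
by rewrite /y; lia.
Qed.

End Membership.

(** * Natural vectors with given support and bounded sum *)

Section BoundedVectors.
Variable T : finType.

(** A tuple is read along [enum A]; outside [A] the index overflows and the default 0 of [nth] is
    returned. This form makes the library count of bounded tuples applicable. *)
Definition tuple_vec {A : {set T}} {m} (w : #|A|.-tuple 'I_m.+1) : {ffun T -> nat} :=
  [ffun i => nth 0 (map val w) (index i (enum A))]%N.

Lemma tuple_vec_out {A : {set T}} {m} (w : #|A|.-tuple 'I_m.+1) i : i \notin A -> tuple_vec w i = 0%N.
Proof.
move=> nAi; rewrite ffunE nth_default // size_map size_tuple memNindex ?mem_enum //.
by rewrite -cardE.
Qed.

Lemma tuple_vec_map (A : {set T}) m (w : #|A|.-tuple 'I_m.+1) :
  map (tuple_vec w) (enum A) = map val w.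
Proof.
have sz : size (map val w) = size (enum A) by rewrite size_map size_tuple -cardE.
apply: (@eq_from_nth _ 0%N) => [|i]; rewrite size_map // => lti.
have x0 : T by case: (enum A) lti.
rewrite (nth_map x0) // ffunE index_uniq ?enum_uniq //.
Qed.

Lemma tuple_vec_inj (A : {set T}) m : injective (@tuple_vec A m).
Proof.
move=> w1 w2 eqw; apply/val_inj/(inj_map val_inj).
by rewrite -!tuple_vec_map eqw.
Qed.

Lemma tuple_vec_sum (A : {set T}) m (w : #|A|.-tuple 'I_m.+1) :
  (\sum_i tuple_vec w i = \sum_(i <- w) i)%N.
Proof.
rewrite (bigID (mem A)) /= [X in (_ + X)%N]big1 ?addn0; last by move=> i; apply: tuple_vec_out.
by rewrite -big_enum -(big_map (tuple_vec w) xpredT id) tuple_vec_map big_map.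
Qed.

Definition bounded_vecs (A : {set T}) (m : nat) : seq {ffun T -> nat} :=
  map (@tuple_vec A m) (enum [set w : #|A|.-tuple 'I_m.+1 | \sum_(i <- w) i <= m]%N).

Lemma bounded_vecs_uniq (A : {set T}) m : uniq (bounded_vecs A m).
Proof. by rewrite map_inj_uniq ?enum_uniq //; apply: tuple_vec_inj. Qed.

Lemma size_bounded_vecs (A : {set T}) m : size (bounded_vecs A m) = 'C(#|A| + m, #|A|).
Proof. by rewrite size_map -cardE card_partial_ord_partitions. Qed.

Lemma bounded_vecsP (A : {set T}) m (a : {ffun T -> nat}) :
  reflect ((forall i, i \notin A -> a i = 0%N) /\ (\sum_i a i <= m)%N)
          (a \in bounded_vecs A m).
Proof.
apply: (iffP mapP) => [[w + ->]|[a0 am]].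
  by rewrite mem_enum inE tuple_vec_sum; split=> //; apply: tuple_vec_out.
have lea i : (a i <= m)%N by apply: leq_trans am; rewrite (bigD1 i) //= leq_addr.
pose w : #|A|.-tuple 'I_m.+1 := [tuple of map (fun i => inord (a i)) (enum_tuple A)].
have aE : a = tuple_vec w.
  apply/ffunP => i; have [Ai|nAi] := boolP (i \in A); last by rewrite a0 ?tuple_vec_out.
  rewrite ffunE -map_comp (nth_map i) ?nth_index ?mem_enum //=; last first.
    by rewrite index_mem mem_enum.
  by rewrite inordK // ltnS.
by exists w; rewrite // mem_enum inE -tuple_vec_sum -aE.
Qed.

(** Without the guard, truncated subtraction would admit the zero vector when [k > m]. *)
Definition shifted_vecs (A : {set T}) (k m : nat) : seq {ffun T -> nat} :=
  if (k <= m)%N then bounded_vecs A (m - k) else [::].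

Lemma shifted_vecs_uniq (A : {set T}) k m : uniq (shifted_vecs A k m).
Proof. by rewrite /shifted_vecs; case: ifP => // _; apply: bounded_vecs_uniq. Qed.

(** For [k > m] the list is empty, and [k <= #|A|] puts the upper entry of the binomial below
    [#|A|], so it vanishes too. *)
Lemma size_shifted_vecs (A : {set T}) k m : (k <= #|A|)%N ->
  size (shifted_vecs A k m) = 'C(m + (#|A| - k), #|A|).
Proof.
move=> lekA; rewrite /shifted_vecs; case: ifP => lekm.
  by rewrite size_bounded_vecs; congr 'C(_, _); lia.
by rewrite bin_small //=; lia.
Qed.

Lemma shifted_vecsP (A : {set T}) k m (a : {ffun T -> nat}) :
  reflect ((forall i, i \notin A -> a i = 0%N) /\ (\sum_i a i + k <= m)%N)
          (a \in shifted_vecs A k m).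
Proof.
rewrite /shifted_vecs; case: ifP => lekm.
  apply: (iffP (bounded_vecsP _ _ _)) => -[a0 am]; split=> //; lia.
by apply: (iffP idP) => // -[_]; lia.
Qed.

End BoundedVectors.

(** * Integer points of fixed total as triples [P], [a], [b] *)

Section Decomposition.
Variables (T : finType) (e : T) (s : int).
Implicit Types (z : {ffun T -> int}) (P : {set T}) (a b : {ffun T -> nat}).

Definition pos_set z : {set T} := [set i | (i != e) && (0 < z i)].

(** One unit is removed because the indicator of [P] carries it; what remains is an arbitrary
    natural vector on [P]. *)
Definition pos_part z : {ffun T -> nat} :=
  [ffun i => if i \in pos_set z then `|z i - 1|%N else 0%N].

Definition neg_part z : {ffun T -> nat} :=
  [ffun i => if i \in ~: (e |: pos_set z) then `|z i|%N else 0%N].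

Definition off_point P a b (i : T) : int := (i \in P)%:Z + (a i)%:Z - (b i)%:Z.

(* The coordinate at [e] is adjusted so that the total is [s]. *)
Definition point_of P a b : {ffun T -> int} :=
  [ffun i => off_point P a b i +
             (if i == e then s - \sum_j off_point P a b j else 0)].

Lemma sum_point_of P a b : \sum_i point_of P a b i = s.
Proof.
under eq_bigr do rewrite ffunE.
by rewrite big_split -big_mkcond big_pred1_eq /= addrC subrK.
Qed.

Section Valid.
Variables (P : {set T}) (a b : {ffun T -> nat}).
Hypotheses (nPe : e \notin P) (a0 : forall i, i \notin P -> a i = 0%N).
Hypothesis b0 : forall i, i \notin ~: (e |: P) -> b i = 0%N.

Lemma point_of_off i : i != e -> point_of P a b i = off_point P a b i.
Proof. by move=> /negPf nie; rewrite ffunE nie addr0. Qed.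

Lemma point_of_pos i : i \in P -> point_of P a b i = 1 + (a i)%:Z.
Proof.
move=> Pi; rewrite point_of_off; last by apply: contraNneq nPe => <-.
by rewrite /off_point Pi b0 ?subr0 // !inE Pi orbT.
Qed.

Lemma point_of_neg i : i \in ~: (e |: P) -> point_of P a b i = - (b i)%:Z.
Proof.
rewrite !inE negb_or => /andP[nie nPi].
by rewrite point_of_off // /off_point (negPf nPi) a0 // !add0r.
Qed.

Lemma pos_set_point_of : pos_set (point_of P a b) = P.
Proof.
apply/setP => i; rewrite inE; have [->|nie] := eqVneq i e; first by rewrite (negPf nPe).
have [Pi|nPi] := boolP (i \in P); first by rewrite point_of_pos //; lia.
by rewrite point_of_neg ?inE ?negb_or ?nie //=; lia.
Qed.

Lemma pos_part_point_of : pos_part (point_of P a b) = a.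
Proof.
apply/ffunP => i; rewrite ffunE pos_set_point_of.
by have [Pi|/a0->//] := boolP (i \in P); rewrite point_of_pos //; lia.
Qed.

Lemma neg_part_point_of : neg_part (point_of P a b) = b.
Proof.
apply/ffunP => i; rewrite ffunE pos_set_point_of.
by have [Ni|/b0->//] := boolP (i \in ~: (e |: P)); rewrite point_of_neg //; lia.
Qed.

End Valid.

Lemma pos_set_e z : e \notin pos_set z.
Proof. by rewrite inE eqxx. Qed.

Lemma pos_part_out z i : i \notin pos_set z -> pos_part z i = 0%N.
Proof. by rewrite ffunE => /negPf ->. Qed.

Lemma neg_part_out z i : i \notin ~: (e |: pos_set z) -> neg_part z i = 0%N.
Proof. by rewrite ffunE => /negPf ->. Qed.

Lemma off_point_parts z i : i != e ->
  off_point (pos_set z) (pos_part z) (neg_part z) i = z i.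
Proof.
move=> nie; rewrite /off_point !ffunE !inE nie /=.
by case: ifP; case: ifP; lia.
Qed.

(** The coordinates off [e] are recovered directly, and the total then forces the one at [e]. *)
Lemma point_of_parts z : \sum_i z i = s ->
  point_of (pos_set z) (pos_part z) (neg_part z) = z.
Proof.
move=> sz; apply/ffunP=> i; rewrite ffunE; case: eqP => [->|/eqP nie]; last first.
  by rewrite off_point_parts ?addr0.
have szD := bigD1 (P := predT) (F := z) e isT.
rewrite (bigD1 e) //= -sz {}szD /= [X in _ - (_ + X)](eq_bigr z) => [|j nje]; first ring.
exact: off_point_parts.
Qed.

Lemma sum_pos_set z :
  \sum_(i in pos_set z) z i = #|pos_set z|%:Z + (\sum_i pos_part z i)%N%:Z.
Proof.
rewrite [X in _ + Posz X](bigID (mem (pos_set z))) /= [X in (_ + X)%N]big1 ?addn0; last first.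
  by move=> i; apply: pos_part_out.
rewrite -sum1_card -PoszD -big_split /= (big_morph Posz PoszD (erefl 0%:Z)).
by apply: eq_bigr => i zi; rewrite ffunE zi; move: zi; rewrite inE; lia.
Qed.

Lemma sum_neg_set z :
  \sum_(i in ~: (e |: pos_set z)) z i = - (\sum_i neg_part z i)%N%:Z.
Proof.
rewrite [X in - Posz X](bigID (mem (~: (e |: pos_set z)))) /= [X in (_ + X)%N]big1 ?addn0; last first.
  by move=> i; apply: neg_part_out.
rewrite (big_morph Posz PoszD (erefl 0%:Z)) -sumrN.
apply: eq_bigr => i zi; rewrite ffunE zi; move: zi; rewrite !inE negb_or.
by case/andP => ->; lia.
Qed.

End Decomposition.

(** * Counting the lattice points of the Minkowski sum *)

Section Counting.
Variables (T : finType) (r : {set T} -> nat).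
Hypothesis r_matroid : matroid_rank r.
Variable e : T.

Definition nullity (S : {set T}) : nat := (#|S| - r S)%N.
Definition corank (S : {set T}) : nat := (r setT - r S)%N.

Section Params.
Variables (t u : nat).
Let s : int := (r setT)%:Z + u%:Z - t%:Z.

Definition minkowski_parts (z : {ffun T -> int}) : Prop :=
  [/\ \sum_i z i = s,
      (\sum_i pos_part T e z i + nullity (pos_set T e z) <= u)%N
    & (\sum_i neg_part T e z i + corank (e |: pos_set T e z) <= t)%N].

(** The bounds on [a] and [b] are the rank inequalities for [P] and for [e |: P], the latter
    rewritten through the total. *)
Lemma in_minkowskiP (R : realFieldType) z :
  in_minkowski R r t u z <-> minkowski_parts z.
Proof.
have sumP := sum_pos_set T e z; have sumN := sum_neg_set T e z.
have sumA : \sum_i z i = \sum_(i in e |: pos_set T e z) z i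
    + \sum_(i in ~: (e |: pos_set T e z)) z i.
  rewrite (bigID (mem (e |: pos_set T e z))) /=; congr (_ + _).
  by apply: eq_bigl => i; rewrite !inE.
have cP := rank_le_card _ _ r_matroid (pos_set T e z).
have ceP := rankS _ _ r_matroid (e |: pos_set T e z) setT (subsetT _).
rewrite /minkowski_parts /nullity /corank; split=> [zin | [sz]].
  have sz := in_minkowski_sum _ _ _ _ _ _ zin.
  have leP := in_minkowski_le _ _ _ r_matroid _ _ _ (pos_set T e z) zin.
  have leeP := in_minkowski_le _ _ _ r_matroid _ _ _ (e |: pos_set T e z) zin.
  move: sumA leeP leP; rewrite sz sumP sumN => sumA leeP leP.
  (* Subtracting the sum of [neg_part] turns the left side into the total of [z], leaving a bound on
     [neg_part] alone. *)
  move: leeP; rewrite -(lerD2r (- (\sum_i neg_part T e z i)%N%:Z)) -sumA => leeP.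
  by split=> //; lia.
move=> lea leb; apply: (in_minkowski_intro R T r r_matroid t u z e sz).
(* The sign of [z e] decides whether the positive support is [e |: P] or [P]. *)
have [ze|ze] := ltP 0 (z e).
  have -> : [set i | 0 < z i] = e |: pos_set T e z.
    by apply/setP=> i; rewrite !inE; case: eqP => [->|].
  rewrite (eq_bigl (mem (e |: pos_set T e z))); last first.
    by move=> i; rewrite !inE; case: eqP => [->|].
  rewrite -(lerD2r (- (\sum_i neg_part T e z i)%N%:Z)) -sumN -sumA sz sumN /s.
  lia.
have -> : [set i | 0 < z i] = pos_set T e z.
  by apply/setP=> i; rewrite !inE; case: eqP => [->|//]; rewrite ltNge ze.
rewrite (eq_bigl (mem (pos_set T e z))) ?sumP; first lia.
by move=> i; rewrite !inE; case: eqP => [->|//]; rewrite ltNge ze.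
Qed.

Definition part_pairs (P : {set T}) : seq ({ffun T -> nat} * {ffun T -> nat}) :=
  [seq (a, b) | a <- shifted_vecs T P (nullity P) u,
                b <- shifted_vecs T (~: (e |: P)) (corank (e |: P)) t].

Definition minkowski_points : seq {ffun T -> int} :=
  [seq point_of T e s P ab.1 ab.2 | P <- enum [set P : {set T} | e \notin P],
                                    ab <- part_pairs P].

Lemma part_pairsP (P : {set T}) ab : e \notin P -> ab \in part_pairs P ->
  [/\ pos_set T e (point_of T e s P ab.1 ab.2) = P,
      pos_part T e (point_of T e s P ab.1 ab.2) = ab.1,
      neg_part T e (point_of T e s P ab.1 ab.2) = ab.2
    & minkowski_parts (point_of T e s P ab.1 ab.2)].
Proof.
move=> nPe /allpairsP[[a b] [/shifted_vecsP[a0 lea] /shifted_vecsP[b0 leb] ->]] /=.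
by rewrite /minkowski_parts sum_point_of pos_part_point_of ?neg_part_point_of
  ?pos_set_point_of.
Qed.

Lemma minkowski_pointsP z : z \in minkowski_points <-> minkowski_parts z.
Proof.
split=> [/allpairsPdep[P [ab [nPe abP ->]]] | zP].
  by move: nPe; rewrite mem_enum inE => nPe; have [] := part_pairsP P ab nPe abP.
case: (zP) => sz lea leb; apply/allpairsPdep.
exists (pos_set T e z), (pos_part T e z, neg_part T e z); split=> /=.
- by rewrite mem_enum inE pos_set_e.
- apply/allpairsP; exists (pos_part T e z, neg_part T e z); split=> //=.
    by apply/shifted_vecsP; split=> //; apply: pos_part_out.
  by apply/shifted_vecsP; split=> //; apply: neg_part_out.
- by rewrite point_of_parts.
Qed.

(** The triple is read back from the point by [pos_set], [pos_part] and [neg_part]. *)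
Lemma minkowski_points_uniq : uniq minkowski_points.
Proof.
apply: allpairs_uniq_dep.
- exact: enum_uniq.
- move=> P _; apply: allpairs_uniq; [exact: shifted_vecs_uniq..|].
  by move=> [? ?] [? ?].
move=> _ _ /allpairsPdep[P [ab [nPe abP ->]]] /allpairsPdep[P' [ab' [nPe' abP' ->]]] /= eqz.
move: nPe nPe'; rewrite !mem_enum !inE => nPe nPe'.
have [pP pa pb _] := part_pairsP P ab nPe abP.
have [pP' pa' pb' _] := part_pairsP P' ab' nPe' abP'.
rewrite eqz {}pP' {}pa' {}pb' in pP pa pb.
by rewrite pP in abP' pa pb *; case: ab ab' pa pb {abP abP' eqz} => ? ? [? ?] /= -> ->.
Qed.

(** The bounds [nullity P <= #|P|] and [corank (e |: P) <= #|T|.-1 - #|P|] allow [size_shifted_vecs]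
    on both factors; [#|P| - nullity P] is [r P]. *)
Lemma size_minkowski_points :
  size minkowski_points =
    (\sum_(P : {set T} | e \notin P)
       'C(u + r P, #|P|) * 'C(t + (#|T|.-1 - #|P| - corank (e |: P)), #|T|.-1 - #|P|))%N.
Proof.
rewrite size_allpairs_dep sumnE big_map big_enum /=.
apply: eq_big => [P|P]; rewrite inE // => nPe.
have cC : #|~: (e |: P)| = (#|T|.-1 - #|P|)%N.
  by have := cardsC (e |: P); rewrite cardsU1 nPe; lia.
have cP := rank_le_card _ _ r_matroid P.
have := corank_nullity_le _ _ r_matroid (e |: P); rewrite cardsU1 nPe => ceP.
rewrite size_allpairs !size_shifted_vecs /nullity ?leq_subr ?cC ?subKn //.
by rewrite /corank; lia.
Qed.

End Params.
End Counting.

(** * Passing from shifted binomials to powers *)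

(* The guard is needed because of truncated subtraction: ['C(k, 0)] is 1. *)
Definition shift_coef (d k j : nat) : nat := if (j <= d)%N then 'C(k, d - j) else 0%N.

Lemma shift_coef_sum (K : comPzRingType) (n d k : nat) (f : nat -> K) : (d < n)%N ->
  \sum_(j < n) (shift_coef d k j)%:R * f j = \sum_(j < d.+1) 'C(k, d - j)%:R * f j.
Proof.
move=> ltdn; rewrite (big_ord_widen n (fun j => 'C(k, d - j)%:R * f j)) //.
rewrite [RHS]big_mkcond; apply: eq_bigr => j _; rewrite /shift_coef ltnS.
by case: ifP; rewrite ?mul0r.
Qed.

(** By Vandermonde, [shift_coef d k] lists the coefficients of ['C(u + k, d)] in the basis
    ['C(u, j)]. *)
Lemma shift_coef_binomial (n d k u : nat) : (d < n)%N ->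
  \sum_(j < n) (shift_coef d k j)%:R * 'C(u, j)%:Z = 'C(u + k, d)%:Z.
Proof.
move=> ltdn; rewrite (shift_coef_sum _ _ _ _ (fun j => 'C(u, j)%:Z)) //.
rewrite -binomial.Vandermonde (big_morph Posz PoszD (erefl 0%:Z)).
by apply: eq_bigr => j _; rewrite PoszM mulrC natz.
Qed.

(** After ['C(u, j)] is replaced by [(y - 1) ^+ j], the factor [(y - 1) ^+ (d - k)] comes out and
    the rest is the expansion of [((y - 1) + 1) ^+ k]. *)
Lemma shift_coef_power (K : comPzRingType) (n d k : nat) (y : K) : (k <= d < n)%N ->
  \sum_(j < n) (shift_coef d k j)%:R * (y - 1) ^+ j = (y - 1) ^+ (d - k) * y ^+ k.
Proof.
move=> /andP[lekd ltdn]; rewrite (shift_coef_sum _ _ _ _ (fun j => (y - 1) ^+ j)) //.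
have -> : y ^+ k = \sum_(i < k.+1) ((y - 1) ^+ (k - i) * 1 ^+ i *+ 'C(k, i)).
  by rewrite -exprDn subrK.
(* The reversal [j -> d - j] aligns the two sums; the terms beyond [k] vanish with their
   binomial. *)
rewrite mulr_sumr (reindex_inj rev_ord_inj) /=.
rewrite (big_ord_widen d.+1
  (fun i => (y - 1) ^+ (d - k) * ((y - 1) ^+ (k - i) * 1 ^+ i *+ 'C(k, i)))) //.
rewrite [RHS]big_mkcond; apply: eq_bigr => i _; rewrite subSS subKn -1?ltnS //.
case: ltnP => ik; last by rewrite bin_small // mul0r.
rewrite expr1n mulr1 mulrnAr -exprD mulr_natl; congr (_ ^+ _ *+ _); lia.
Qed.

(** * The coefficients of the counting polynomial *)

Section Coefficients.
Variables (T : finType) (r : {set T} -> nat).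
Hypothesis r_matroid : matroid_rank r.
Variable e : T.

(* The size of the complement of [e |: P] when [e \notin P]. *)
Definition cocard (P : {set T}) : nat := (#|T|.-1 - #|P|)%N.

Definition minkowski_coef : {ffun 'I_#|T| * 'I_#|T| -> int} :=
  [ffun ij : 'I_#|T| * 'I_#|T| => \sum_(P : {set T} | e \notin P)
     (shift_coef (cocard P) (cocard P - corank T r (e |: P)) ij.1 *
      shift_coef #|P| (r P) ij.2)%N%:Z].

(** With binomials for [f] and [g] this evaluates [Qbinom], with powers it evaluates [Qprime]. *)
Lemma minkowski_coef_sum (K : comNzRingType) (f g : nat -> K) :
  \sum_(i < #|T|) \sum_(j < #|T|) (minkowski_coef (i, j))%:~R * f i * g j =
  \sum_(P : {set T} | e \notin P)
    (\sum_(i < #|T|) (shift_coef (cocard P) (cocard P - corank T r (e |: P)) i)%:R * f i) *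
    (\sum_(j < #|T|) (shift_coef #|P| (r P) j)%:R * g j).
Proof.
under [RHS]eq_bigr do rewrite big_distrlr /=.
rewrite [RHS]exchange_big; apply: eq_bigr => i _.
rewrite [RHS]exchange_big; apply: eq_bigr => j _.
rewrite ffunE rmorph_sum !mulr_suml; apply: eq_bigr => P _ /=.
by rewrite -pmulrn natrM; ring.
Qed.

Lemma card_lt_notin (P : {set T}) : e \notin P -> (#|P| < #|T|)%N.
Proof. by move=> nPe; have := max_card (mem (e |: P)); rewrite cardsU1 nPe add1n. Qed.

Lemma Qbinom_minkowski_coef t u :
  Qbinom minkowski_coef t u = (size (minkowski_points T r e t u))%:Z.
Proof.
rewrite (size_minkowski_points _ _ r_matroid) (big_morph Posz PoszD (erefl 0%:Z)).
transitivity (\sum_(i < #|T|) \sum_(j < #|T|)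
    (minkowski_coef (i, j))%:~R * 'C(t, i)%:Z * 'C(u, j)%:Z).
  by apply: eq_bigr => i _; apply: eq_bigr => j _; rewrite intz mulrAC.
rewrite (minkowski_coef_sum int (fun i => 'C(t, i)%:Z) (fun j => 'C(u, j)%:Z)).
apply: eq_bigr => P nPe; have ltP := card_lt_notin P nPe.
by rewrite !shift_coef_binomial ?PoszM 1?mulrC // /cocard; lia.
Qed.

(** * Comparison with the Tutte polynomial *)

Section Tutte.
Variables (K : fieldType) (x y : K).

(** The summand of [S] in the rescaled Tutte polynomial, with denominators cleared. *)
Definition tutte_term (S : {set T}) : K :=
  (x - 1) ^+ corank T r S * (y - 1) ^+ nullity T r S *
  y ^+ r S * x ^+ (#|T| - r setT - nullity T r S).

(** If [e] leaves the rank of [P] unchanged, the nullity grows by one and the common factor is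
    multiplied by [x + (y - 1)]; otherwise the corank drops by one and the multiplier is
    [(x - 1) + y]. *)
Lemma tutte_term_pair (P : {set T}) : e \notin P ->
  tutte_term P + tutte_term (e |: P) =
  (x - 1) ^+ corank T r (e |: P) * x ^+ (cocard P - corank T r (e |: P)) *
  ((y - 1) ^+ nullity T r P * y ^+ r P) * (x + y - 1).
Proof.
move=> nPe; have cP := cardsU1 e P; rewrite nPe add1n in cP.
have ltP := card_lt_notin P nPe.
have leP := rank_le_card _ _ r_matroid P.
have le1 := rankU1_le _ _ r_matroid P e.
have leU := rankS _ _ r_matroid P (e |: P) (subsetUr _ _).
have leT := rankS _ _ r_matroid (e |: P) setT (subsetT _).
have leC := corank_nullity_le _ _ r_matroid P.
have leCe := corank_nullity_le _ _ r_matroid (e |: P).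
rewrite /tutte_term /cocard /corank /nullity; rewrite !cP in leCe *.
move: (r P) (r (e |: P)) (r setT) #|P| #|T| ltP leP le1 leU leT leC leCe {cP}.
move=> p q m c n ltP leP le1 leU leT leC leCe.
have [qE|qE] : q = p \/ q = p.+1 by lia.
  rewrite qE.
  have -> : (n - m - (c - p) = (n.-1 - c - (m - p)).+1)%N by lia.
  have -> : (c.+1 - p = (c - p).+1)%N by lia.
  have -> : (n - m - (c - p).+1 = n.-1 - c - (m - p))%N by lia.
  by rewrite !exprS; ring.
rewrite qE.
have -> : (n - m - (c - p) = n.-1 - c - (m - p.+1))%N by lia.
have -> : (m - p = (m - p.+1).+1)%N by lia.
rewrite subSS.
by rewrite !exprS; ring.
Qed.

Lemma Qprime_minkowski_coef :
  Qprime minkowski_coef x y * (x + y - 1) = \sum_(S : {set T}) tutte_term S.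
Proof.
rewrite /Qprime (minkowski_coef_sum K (fun i => (x - 1) ^+ i) (fun j => (y - 1) ^+ j)).
rewrite mulr_suml [RHS](bigID (fun S : {set T} => e \in S)) /= [RHS]addrC.
(* Subsets containing [e] are indexed by [P] avoiding [e], to pair each with its partner. *)
rewrite [X in _ = _ + X](reindex_onto (fun P => e |: P) (fun S => S :\ e)) /=; last first.
  by move=> S; apply: setD1K.
rewrite [X in _ = _ + X](eq_bigl (fun P : {set T} => e \notin P)); last first.
  move=> P; rewrite setU11 /=; apply/eqP/idP => [<-|nPe]; first by rewrite !inE eqxx.
  exact: setU1K.
rewrite -big_split; apply: eq_bigr => P nPe /=.
have ltP := card_lt_notin P nPe.
have leP := rank_le_card _ _ r_matroid P.
have leC : (corank T r (e |: P) <= cocard P)%N.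
  have := corank_nullity_le _ _ r_matroid (e |: P).
  by rewrite cardsU1 nPe /corank /cocard; lia.
rewrite tutte_term_pair // !shift_coef_power ?subKn ?leP ?leq_subr //=.
by rewrite (leq_ltn_trans (leq_subr _ _)) // prednK // (leq_ltn_trans _ ltP).
Qed.

Lemma tutte_term_sum : x != 0 -> y != 0 ->
  x ^+ (#|T| - r setT) * y ^+ r setT *
    tutte r ((x + y - 1) / y) ((x + y - 1) / x) = \sum_(S : {set T}) tutte_term S.
Proof.
move=> x0 y0; rewrite /tutte mulr_sumr; apply: eq_bigr => S _.
have -> : (x + y - 1) / y - 1 = (x - 1) / y by field.
have -> : (x + y - 1) / x - 1 = (y - 1) / x by field.
have leT := rankS _ _ r_matroid S setT (subsetT _).
have leC := corank_nullity_le _ _ r_matroid S.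
have leS := rank_le_card _ _ r_matroid S.
rewrite /tutte_term -/(corank T r S) -/(nullity T r S) !expr_div_n.
(* The exponents of the prefactor are split so that one part cancels the denominators of the
   summand. *)
have {1}-> : (#|T| - r setT = nullity T r S + (#|T| - r setT - nullity T r S))%N.
  by rewrite /nullity; lia.
have {2}-> : r setT = (corank T r S + r S)%N by rewrite subnK.
rewrite !exprD; field.
by rewrite !expf_neq0.
Qed.

End Tutte.
End Coefficients.

Theorem mainTheorem1 (T : finType) (r : {set T} -> nat) :
  matroid_rank r -> (0 < #|T|)%N ->
  exists c : {ffun 'I_#|T| * 'I_#|T| -> int},
    (forall (R : realFieldType) (t u : nat),
        exists N : nat, card_is (in_minkowski R r t u) N /\ N%:Z = Qbinom c t u) /\
    (forall (K : fieldType) (x y : K),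
        x != 0 -> y != 0 -> x + y - 1 != 0 ->
        Qprime c x y =
          x ^+ (#|T| - r setT) * y ^+ (r setT) / (x + y - 1) *
            tutte r ((x + y - 1) / y) ((x + y - 1) / x)).
Proof.
(* Nonemptiness of the ground set supplies the distinguished element. *)
move=> r_matroid /card_gt0P[e _]; exists (minkowski_coef T r e); split.
  move=> R t u; exists (size (minkowski_points T r e t u)).
  rewrite Qbinom_minkowski_coef //; split=> //.
  exists (minkowski_points T r e t u); split=> //; first exact: minkowski_points_uniq.
  move=> z; apply: iff_trans (minkowski_pointsP T r e t u z) _.
  exact: iff_sym (in_minkowskiP T r r_matroid e t u R z).
move=> K x y x0 y0 D0.
rewrite mulrAC tutte_term_sum // -(Qprime_minkowski_coef _ _ r_matroid e).
by rewrite mulfK.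
Qed.
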